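(* In the network slicing model described in the context, let $v\in\mathcal V$. The BTD gain of SCPF over GPS for slice $v$, $G_v^{GPS}=\mathbb{E}^v[1/R^{v,GPS}]\,/\,\mathbb{E}^v[1/R^{v}]$, is $$G_v^{GPS}=\frac{\rho^v\left(\|\tilde{\boldsymbol\rho}^v\|_{\boldsymbol\Delta^v}^2-\|\tilde{\boldsymbol\rho}^v\|_{\boldsymbol\Delta^v\boldsymbol S^v}^2\right)+\langle\tilde{\boldsymbol\rho}^v,\mathbf 1-\bar{\boldsymbol s}^v\rangle_{\boldsymbol\Delta^v}}{s^v\langle\boldsymbol\delta^v,\tilde{\boldsymbol\rho}^v\rangle-s^v\left(1-(\rho^v+1)e^{-\rho^v}\right)\|\tilde{\boldsymbol\rho}^v\|_{\boldsymbol\Delta^v}^2+(\rho^v+1)\langle\tilde{\boldsymbol g}',\tilde{\boldsymbol\rho}^v\rangle_{\boldsymbol\Delta^v}}.$$ Moreover, with the relative loads $(\tilde{\boldsymbol\rho}^w:w\in\mathcal V)$ (and shares and mean reciprocal capacities) fixed: (i) as $\rho^v\to0$ with the other overall loads $(\rho^{w})_{w\ne v}$ fixed, $G_v^{GPS}$ tends to $$G_v^{GPS,L}=\frac{\langle\tilde{\boldsymbol\rho}^v,\mathbf 1-\bar{\boldsymbol s}^v\rangle_{\boldsymbol\Delta^v}}{s^v\langle\boldsymbol\delta^v,\tilde{\boldsymbol\rho}^v\rangle+\langle\tilde{\boldsymbol g}',\tilde{\boldsymbol\rho}^v\rangle_{\boldsymbol\Delta^v}},$$ where $\tilde{\boldsymbol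 g}'$ is evaluated at $\rho^v=0$; (ii) as $\rho^w\to0$ for all $w\in\mathcal V$, $G_v^{GPS,L}\to1$; (iii) as $\rho^w\to\infty$ for all $w\in\mathcal V$, $G_v^{GPS}$ tends to $$G_v^{GPS,H}=\frac{\|\tilde{\boldsymbol\rho}^v\|_{\boldsymbol\Delta^v}^2-\|\tilde{\boldsymbol\rho}^v\|_{\boldsymbol\Delta^v\boldsymbol S^v}^2}{\langle\tilde{\boldsymbol g},\tilde{\boldsymbol\rho}^v\rangle_{\boldsymbol\Delta^v}},$$ where $\boldsymbol S^v$ on the right-hand side is taken at its limiting value as all overall loads tend to infinity.
   Context: Model. $\mathcal B$ (base stations) and $\mathcal V$ (slices) are finite nonempty sets. Each slice $v$ has a share $s^v>0$, with $\sum_{v\in\mathcal V}s^v=1$. The number $N_b^v$ of customers of slice $v$ at base station $b$ is Poisson with mean $\rho_b^v\ge 0$, and the variables $(N_b^v)_{b,v}$ are mutually independent. Put $N^v=\sum_b N_b^v$, $\rho^v=\sum_b\rho_b^v>0$ (overall load). Each customer $u$ of slice $v$ at base station $b$ has a peak rate $c_u>0$; the peak rates are independent of each other and of the counts, and $c_u$ is distributed as a random variable $C_b^v$ with $\delta_b^v:=\mathbb E[1/C_b^v]\in(0,\infty)$. Rates. When the counts are $n_b^v$ and $n^v=\sum_b n_b^v$, a customer $u$ of slice $v$ at base station $b$ receives rate $r_u^{GPS}=\frac{s^v}{n_b^v\sum_{w\in\mathcal V}s^{w}\mathbf 1_{\{n_b^{w}>0\}}}c_u$ under General Processor Sharing (GPS),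 and $r_u^{SCPF}=\frac{s^v/n^v}{\sum_{w\in\mathcal V:\,n^w>0}n_b^{w}s^{w}/n^{w}}c_u$ under Share Constrained Proportionally Fair (SCPF) sharing. Mean bit transmission delay (BTD) of a typical customer (Palm expectation): $\mathbb E^v[1/R^v]=\frac1{\rho^v}\mathbb E\big[\sum_{b}\sum_{u\in\mathcal U_b^v}1/r_u^{SCPF}\big]$, where $\mathcal U_b^v$ is the set of the $N_b^v$ customers of slice $v$ at $b$; $\mathbb E^v[1/R^{v,GPS}]$ is defined likewise with $r_u^{GPS}$. Notation. $\tilde\rho_b^v=\rho_b^v/\rho^v$, $\tilde{\boldsymbol\rho}^v=(\tilde\rho_b^v)_b$; $\tilde{\boldsymbol g}=(\tilde g_b)_b$ with $\tilde g_b=\sum_{w\in\mathcal V}s^w\tilde\rho_b^w$; $\tilde{\boldsymbol g}'=(\tilde g_b')_b$ with $\tilde g_b'=\sum_{w\in\mathcal V}s^w(1-e^{-\rho^w})\tilde\rho_b^w$; $\bar{\boldsymbol s}^v=(\bar s_b^v)_b$ with $\bar s_b^v=\sum_{w\ne v}s^{w}e^{-\rho_b^{w}}$; $\boldsymbol S^v=\mathrm{diag}(\bar{\boldsymbol s}^v)$; $\boldsymbol\delta^v=(\delta_b^v)_b$, $\boldsymbol\Delta^v=\mathrm{diag}(\boldsymbol\delta^v)$; $\mathbf 1$ is the all-ones vector. For a diagonal matrix $\boldsymbol M$, $\langle\boldsymbol x,\boldsymbol y\rangle_{\boldsymbol M}=\boldsymbol x^T\boldsymbol M\boldsymbol y$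 and $\|\boldsymbol x\|_{\boldsymbol M}^2=\boldsymbol x^T\boldsymbol M\boldsymbol x$; $\langle\cdot,\cdot\rangle$ without subscript is the standard inner product. *)

(* Defs.v *)
(* MathComp / MathComp-Analysis, over an arbitrary realType. *)
From HB Require Import structures.
From mathcomp Require Import all_boot all_order all_algebra.
From mathcomp Require Import all_classical all_reals all_analysis.

Set Implicit Arguments.
Unset Strict Implicit.
Unset Printing Implicit Defensive.

Import Order.TTheory GRing.Theory Num.Theory.
Import numFieldNormedType.Exports.

Local Open Scope classical_set_scope.
Local Open Scope ring_scope.

Section Independence.
Context {d : measure_display} {T : measurableType d} {R : realType}.
Local Open Scope ereal_scope.

(* Mutual independence of a (possibly infinite) family of systems of events:
   the product rule for every finite subfamily. *)
Definition mutually_independent (P : probability T R) (I : eqType)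
    (F : I -> set (set T)) : Prop :=
  forall (J : seq I) (E : I -> set T), uniq J ->
    (forall i, i \in J -> F i (E i)) ->
    P (\big[setI/setT]_(i <- J) E i) = \big[*%E/1]_(i <- J) P (E i).

End Independence.

Section Model.
Context {R : realType} {B V : finType}.
Implicit Types (s : V -> R) (rho q : B -> V -> R) (r : V -> R)
  (delta : B -> V -> R) (b : B) (v w : V).

(* The customers of slice [w] at base station [b] are numbered 0, 1, 2, ...;
   [peak_rate b w k] is the peak rate of customer number [k], and in the outcome
   [omega] the customers present are those with [k < customers b w omega]. *)
Record slicing_system := SlicingSystem {
  sample_disp : measure_display;
  sample_space : measurableType sample_disp;
  sample_prob : probability sample_space R;
  customers : B -> V -> {RV sample_prob >-> nat};
  peak_rate : B -> V -> nat -> {RV sample_prob >-> R};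
  capacity : B -> V -> {RV sample_prob >-> R} }.

(* The counts and the peak rates form one family of random variables, indexed
   by a disjoint sum; [system_events] gives the sigma-algebra generated by each
   of them. *)
Definition system_events (M : slicing_system)
    (i : (B * V) + (B * V * nat)) : set (set (sample_space M)) :=
  match i with
  | inl (b, w) => g_sigma_algebra_preimage (customers M b w)
  | inr (b, w, k) => g_sigma_algebra_preimage (peak_rate M b w k)
  end.

(* [poisson_prob m k] does not depend on its argument [k], and is the Dirac
   mass at 0 when [m] is 0. *)
Record slicing_model rho delta (M : slicing_system) : Prop := SlicingModel {
  count_poisson : forall b w (A : set nat),
    distribution (sample_prob M) (customers M b w) A = poisson_prob (rho b w) 0%N A;
  peak_gt0 : forall b w k omega, 0 < peak_rate M b w k omega;
  peak_law : forall b w k (A : set R), measurable A ->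
    distribution (sample_prob M) (peak_rate M b w k) A =
    distribution (sample_prob M) (capacity M b w) A;
  mean_reciprocal_capacity : forall b w,
    ('E_(sample_prob M)[fun omega => ((capacity M b w omega)^-1)%R] = (delta b w)%:E)%E;
  system_independent :
    mutually_independent (sample_prob M) (@system_events M) }.

(* Rates: [n] is the array of counts, [v] the slice and [b] the base station of
   the customer, [c] the peak rate of the customer. *)
Definition rate_gps s (n : B -> V -> nat) b v (c : R) : R :=
  s v / ((n b v)%:R * \sum_(w | (0 < n b w)%N) s w) * c.

Definition slice_count (n : B -> V -> nat) v : nat := (\sum_b n b v)%N.

Definition rate_scpf s (n : B -> V -> nat) b v (c : R) : R :=
  (s v / (slice_count n v)%:R) /
  (\sum_(w | (0 < slice_count n w)%N)
     (n b w)%:R * s w / (slice_count n w)%:R) * c.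

Definition overall_load rho v : R := \sum_b rho b v.

Definition relative_load rho b v : R := rho b v / overall_load rho v.

Definition load_of r q b w : R := r w * q b w.

Definition set_load r v (x : R) : V -> R := fun w => if w == v then x else r w.

(* Mean bit transmission delay of a typical customer of slice [v]. *)
Definition mean_btd (rate : (B -> V -> nat) -> B -> V -> R -> R)
    rho (M : slicing_system) v : \bar R :=
  ((overall_load rho v)^-1%:E *
   'E_(sample_prob M)[fun omega =>
      (\sum_b \sum_(k < customers M b v omega)
         (rate (fun b' w => customers M b' w omega) b v
               (peak_rate M b v k omega))^-1)%R])%E.

Definition btd_gain s rho (M : slicing_system) v : \bar R :=
  (mean_btd (rate_gps s) rho M v / mean_btd (rate_scpf s) rho M v)%E.

Definition g_tilde s q b : R := \sum_w s w * q b w.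

Definition g_tilde' s r q b : R := \sum_w s w * (1 - expR (- r w)) * q b w.

Definition s_bar s rho v b : R := \sum_(w | w != v) s w * expR (- rho b w).

Definition vec (f : B -> R) : 'cV[R]_#|B| := \col_j f (enum_val j).

Definition diag (f : B -> R) : 'M[R]_#|B| := diag_mx (vec f)^T.

Definition inner (x y : 'cV[R]_#|B|) : R := (x^T *m y) 0 0.

Definition winner (A : 'M[R]_#|B|) (x y : 'cV[R]_#|B|) : R :=
  (x^T *m A *m y) 0 0.

Definition wsqnorm (A : 'M[R]_#|B|) (x : 'cV[R]_#|B|) : R := winner A x x.

Definition gain_formula s delta rho v : R :=
  let rv := overall_load rho v in
  let qv := vec (relative_load rho ^~ v) in
  let Delta := diag (delta ^~ v) in
  let sb := vec (s_bar s rho v) in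
  let S := diag (s_bar s rho v) in
  let g' := vec (g_tilde' s (overall_load rho) (relative_load rho)) in
  (rv * (wsqnorm Delta qv - wsqnorm (Delta *m S) qv)
     + winner Delta qv (const_mx 1 - sb)) /
  (s v * inner (vec (delta ^~ v)) qv
     - s v * (1 - (rv + 1) * expR (- rv)) * wsqnorm Delta qv
     + (rv + 1) * winner Delta g' qv).

(* [r] only matters through the loads of the slices other than [v]. *)
Definition gain_light s delta r q v : R :=
  let qv := vec (q ^~ v) in
  let Delta := diag (delta ^~ v) in
  let sb := vec (s_bar s (load_of r q) v) in
  let g' := vec (g_tilde' s (set_load r v 0) q) in
  winner Delta qv (const_mx 1 - sb) /
  (s v * inner (vec (delta ^~ v)) qv + winner Delta g' qv).

(* [sbH] stands for the limiting value of [s_bar]. *)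
Definition gain_heavy s delta q (sbH : B -> R) v : R :=
  let qv := vec (q ^~ v) in
  let Delta := diag (delta ^~ v) in
  let S := diag sbH in
  (wsqnorm Delta qv - wsqnorm (Delta *m S) qv) /
  winner Delta (vec (g_tilde s q)) qv.

(* The filter on vectors of overall loads along which all the coordinates
   converge simultaneously along [F]: the product filter, as [V] is finite. *)
Definition all_loads (F : set_system R) : set_system (V -> R) :=
  filter_from F (fun A => [set r | forall w, A (r w)]).

End Model.

Arguments slicing_system : clear implicits.

(* Main.v *)
(* Conditionally on the array of counts, the peak rates are independent of it,
   so the mean delay is a weighted sum, over base stations, of the means of
   explicit functions of an array of independent Poisson counts. These means
   follow from Mecke's formula E[N_i f(N)] = rho_i E[f(N + e_i)]: weighting by a
   count amounts to adding one customer. The fractions N_b / N^w are handled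
   without the law of N^w: Mecke's formula reduces their means to that of
   1 / (N^w + 1), which is determined by sum_b E[N_b / N^w] = P(N^w > 0).
   The gain is then a quotient of two sums that are homogeneous in a pair of
   coefficients equal to (rho^v, 1), and the limits are those of the pair, up to
   scaling: (0, 1) under light load and (1, 0) under heavy load. *)
Require Import Defs.
From HB Require Import structures.
From mathcomp Require Import all_boot all_order all_algebra.
From mathcomp Require Import all_classical all_reals all_analysis.
From mathcomp Require Import measurable_realfun ring.
Import Order.TTheory GRing.Theory Num.Theory.
Import numFieldNormedType.Exports.
Local Open Scope classical_set_scope.
Local Open Scope ring_scope.

Set Implicit Arguments.
Unset Strict Implicit.
Unset Printing Implicit Defensive.

(** * Integration: independence, equality in law, countable partitions *)

Section Measure.
Context {d : measure_display} {T : measurableType d} {R : realType}.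

(** Inversion is continuous off 0, and every function is measurable on a singleton. *)
Lemma measurable_fun_invr (D : set R) :
  measurable D -> measurable_fun D (@GRing.inv R).
Proof.
move=> mD; apply: (@measurable_funS _ _ _ _ setT) => //.
rewrite -(setvU [set 0 : R]); apply/measurable_funU => //.
  exact: measurableC.
split; last exact: measurable_fun_set1.
apply: open_continuous_measurable_fun.
  by rewrite openC; exact: closed_eq.
by move=> x; rewrite inE /= => /eqP x0; exact: inv_continuous.
Qed.

Variable P : probability T R.
Local Open Scope ereal_scope.

(** The restriction of [P] to [A], pushed forward by [X], is [P A] times the law of [X]; both
    integrals are compared on the real line. *)
Lemma ge0_integral_indep (A : set T) (X : {RV P >-> R}) (h : R -> \bar R) :
  measurable A -> measurable_fun setT h -> (forall x, 0 <= h x) ->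
  (forall E, measurable E -> P (A `&` X @^-1` E) = P A * P (X @^-1` E)) ->
  \int[P]_(x in A) h (X x) = P A * \int[P]_x h (X x).
Proof.
move=> mA mh h0 AX.
pose PA := mrestr P mA.
have mhX : measurable_fun setT (h \o X) by exact: measurableT_comp.
transitivity (\int[PA]_x h (X x)).
  rewrite [RHS](ge0_negligible_integral (measurableC mA)) //.
  - rewrite setTD setCK; apply/esym/eq_measure_integral => E mE EA.
    by rewrite /PA /= /mrestr setIidl.
  - by rewrite /PA /= /mrestr setICl measure0.
pose a : {nonneg R} := NngNum (fine_ge0 (measure_ge0 P A)).
have PAE : (a%:num)%:E = P A by rewrite /= fineK // fin_num_measure.
rewrite -PAE -[LHS](@ge0_integral_pushforward _ _ _ _ R X _ PA setT h) //.
rewrite -[X in _ = _ * X](@ge0_integral_pushforward _ _ _ _ R X _ P setT h) //.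
rewrite -ge0_integral_mscale //.
apply: eq_measure_integral => E mE _.
transitivity ((a%:num)%:E * P (X @^-1` E)); last by [].
by rewrite PAE -AX // [in RHS]setIC.
Qed.

(** No sign is assumed, so the positive and negative parts of inversion are integrated separately;
    each integral depends on the law alone. *)
Lemma expectation_inv_eq_law (X Y : {RV P >-> R}) :
  (forall E, measurable E -> distribution P X E = distribution P Y E) ->
  'E_P[fun x => (X x)^-1%R] = 'E_P[fun x => (Y x)^-1%R].
Proof.
move=> XY.
have eqlaw (h : R -> \bar R) : measurable_fun setT h -> (forall x, 0 <= h x) ->
    \int[P]_x h (X x) = \int[P]_x h (Y x).
  move=> mh h0.
  rewrite -[LHS](ge0_integral_distribution X) //.
  rewrite -[RHS](ge0_integral_distribution Y) //.
  by apply: eq_measure_integral => E mE _; exact: XY.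
have minv : measurable_fun setT (fun x : R => x^-1%:E).
  by apply/measurable_EFinP; exact: measurable_fun_invr.
pose inv (x : R) := x^-1%:E.
rewrite unlock -[LHS]/(\int[P]_x (inv \o X) x) -[RHS]/(\int[P]_x (inv \o Y) x).
rewrite [LHS]integralE [RHS]integralE (funepos_comp inv X) (funepos_comp inv Y).
rewrite (funeneg_comp inv X) (funeneg_comp inv Y).
congr (_ - _); apply: eqlaw => //.
  exact: measurable_funepos.
exact: measurable_funeneg.
Qed.

(** The fibres of [X] are renumbered by [nat] through [pickle], so that countable additivity along a
    sequence applies. *)
Lemma ge0_integral_countable (C : countType) (X : T -> C) (f : T -> \bar R) :
  (forall c, measurable (X @^-1` [set c])) ->
  (forall c, measurable_fun (X @^-1` [set c]) f) -> (forall x, 0 <= f x) ->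
  \int[P]_x f x = \esum_(c in setT) \int[P]_(x in X @^-1` [set c]) f x.
Proof.
move=> mX mf f0.
pose F k := (pickle \o X) @^-1` [set k].
(* A natural number that codes no element has an empty fibre; [unpickle] may still return some [c]
   for it, hence the test [pickle c == k]. *)
have FE k : F k = if @unpickle C k is Some c then
    if pickle c == k then X @^-1` [set c] else set0 else set0.
  case ck : (unpickle k) => [c|]; last first.
    by apply/seteqP; split => // x /= xk; move: ck; rewrite -xk pickleK.
  case: eqP => [ck'|ck']; apply/seteqP; split => // x /=.
  - by move=> xk; apply/(pcan_inj (@pickleK C)); rewrite ck'.
  - by move=> xc; rewrite -ck' -xc.
  - by move=> xk; apply: ck'; move: ck; rewrite -xk pickleK => -[<-].
have FT : \bigcup_k F k = setT.
  by apply/seteqP; split => // x _; exists (pickle (X x)).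
have mF k : measurable (F k) by rewrite FE; case: unpickle => // c; case: ifP.
rewrite -FT ge0_integral_bigcup //; last 2 first.
- apply/measurable_fun_bigcup => // k; rewrite FE; case: unpickle => [c|].
    by case: ifP => // _; exact: measurable_fun_set0.
  exact: measurable_fun_set0.
- by move=> i j _ _ [x [/= <- <-]].
rewrite nneseries_esumT; last by move=> k; exact: integral_ge0.
rewrite [RHS](_ : _ = \esum_(k in range (@pickle C)) \int[P]_(x in F k) f x).
  rewrite [RHS]esum_mkcond; apply: eq_esum => k _; case: ifPn => // /negP kN.
  rewrite FE; case ck : (unpickle k) => [c|]; last by rewrite integral_set0.
  case: eqP => [ck'|_]; last by rewrite integral_set0.
  by case: kN; rewrite inE; exists c.
rewrite esum_image; last by move=> c c' _ _; exact: (pcan_inj pickleK).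
by apply: eq_esum => c _; rewrite FE pickleK eqxx.
Qed.

End Measure.

(** The sum is a supremum of finite sums. Scaling a supremum requires a nonempty family, and the
    empty sum is a member. *)
Lemma ge0_esumZl (R : realType) (C : choiceType) (a : R) (f : C -> \bar R) :
  (0 <= a)%R -> (forall c, 0 <= f c)%E ->
  (\esum_(c in setT) (a%:E * f c) = a%:E * \esum_(c in setT) f c)%E.
Proof.
move=> a0 f0; rewrite /esum -ereal_supZl //; last first.
  by apply/set0P; exists (\sum_(x \in set0) f x)%E, set0 => //; exact: fsets_set0.
rewrite image_comp; congr ereal_sup; apply: eq_imagel => A [_ _] /=.
by rewrite ge0_mule_fsumr.
Qed.

(** * Means over arrays of independent Poisson counts, and Mecke's formula *)

Section PoissonArrays.
Context {R : realType} {I : finType} (rho : I -> R).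
Hypothesis rho_ge0 : forall i, 0 <= rho i.
Implicit Types (n : {ffun I -> nat}) (f g : {ffun I -> nat} -> R) (i : I).

(* [poisson_pmf 0 k] is 1 for every [k], hence the case distinction. *)
Definition poisson_weight (a : R) (k : nat) : R :=
  if 0 < a then poisson_pmf a k else (k == 0%N)%:R.

Definition array_weight n : R := \prod_i poisson_weight (rho i) (n i).

(** The expectation of [f] under the product Poisson law, for nonnegative [f]; extended real values
    spare any summability condition. *)
Definition array_mean f : \bar R :=
  \esum_(n in setT) (f n * array_weight n)%:E.

Definition incr i n : {ffun I -> nat} := [ffun j => (n j + (j == i))%N].

Lemma poisson_weight_ge0 (a : R) k : 0 <= poisson_weight a k.
Proof. by rewrite /poisson_weight; case: ifP => // _; exact: poisson_pmf_ge0. Qed.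

(** The one-dimensional source of Mecke's formula: [(k+1) / (k+1)! = 1 / k!]. For a zero mean both
    sides vanish. *)
Lemma poisson_weightS (a : R) k : 0 <= a ->
  k.+1%:R * poisson_weight a k.+1 = a * poisson_weight a k.
Proof.
rewrite /poisson_weight le_eqVlt => /predU1P[<-|a0].
  by rewrite ltxx /= mulr0 mul0r.
rewrite a0 /poisson_pmf a0 exprS factS natrM invfM.
have k0 : k.+1%:R != 0 :> R by rewrite pnatr_eq0.
by set c := _`!%:R^-1; field.
Qed.

Lemma array_weight_ge0 n : 0 <= array_weight n.
Proof. by apply: prodr_ge0 => i _; exact: poisson_weight_ge0. Qed.

Lemma array_weight_incr i n :
  (n i).+1%:R * array_weight (incr i n) = rho i * array_weight n.
Proof.
rewrite /array_weight (bigD1 i) //= [in RHS](bigD1 i) //= !mulrA.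
rewrite ffunE eqxx addn1 poisson_weightS //; congr (_ * _).
by apply: eq_bigr => j /negPf ji; rewrite ffunE ji addn0.
Qed.

Lemma array_meanD f g : (forall n, 0 <= f n) -> (forall n, 0 <= g n) ->
  array_mean (fun n => f n + g n) = (array_mean f + array_mean g)%E.
Proof.
move=> f0 g0; rewrite /array_mean -esumD; last 2 first.
- by move=> n _; rewrite lee_fin mulr_ge0 // array_weight_ge0.
- by move=> n _; rewrite lee_fin mulr_ge0 // array_weight_ge0.
by apply: eq_esum => n _; rewrite mulrDl.
Qed.

Lemma array_mean_sum (J : finType) (F : J -> {ffun I -> nat} -> R) :
  (forall j n, 0 <= F j n) ->
  array_mean (fun n => \sum_j F j n) = (\sum_j array_mean (F j))%E.
Proof.
move=> F0; rewrite /array_mean -esum_sum; last first.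
  by move=> n j _ _; rewrite lee_fin mulr_ge0 // array_weight_ge0.
by apply: eq_esum => n _; rewrite mulr_suml -sumEFin.
Qed.

Lemma array_meanZ (a : R) f : 0 <= a -> (forall n, 0 <= f n) ->
  array_mean (fun n => a * f n) = (a%:E * array_mean f)%E.
Proof.
move=> a0 f0; rewrite /array_mean -ge0_esumZl //.
  by apply: eq_esum => n _; rewrite -mulrA.
by move=> n; rewrite lee_fin mulr_ge0 // array_weight_ge0.
Qed.

Lemma eq_array_mean f g : f =1 g -> array_mean f = array_mean g.
Proof. by move=> fg; congr array_mean; apply/funext. Qed.

(* Mecke's formula: sizing by a count amounts to adding one customer. *)
Lemma array_mean_mecke i f : (forall n, 0 <= f n) ->
  array_mean (fun n => (n i)%:R * f n) =
  ((rho i)%:E * array_mean (fun n => f (incr i n)))%E.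
Proof.
move=> f0; rewrite -array_meanZ // /array_mean.
(* Arrays with [n i = 0] contribute nothing, and [incr i] is a bijection from all arrays onto the
   others. *)
transitivity (\esum_(n in [set n : {ffun I -> nat} | (0 < n i)%N]) ((n i)%:R * f n * array_weight n)%:E).
  rewrite [RHS]esum_mkcond; apply: eq_esum => n _; case: ifPn => //.
  by rewrite notin_setE /= => /negP; rewrite -eqn0Ngt => /eqP ->; rewrite !mul0r.
rewrite (@reindex_esum _ _ _ setT _ (incr i)); last first.
  split.
  - by move=> n _ /=; rewrite ffunE eqxx addn1.
  - move=> n m _ _ nm; apply/ffunP => j.
    by move/ffunP/(_ j): nm; rewrite !ffunE => /addIn.
  - move=> n /= ni; exists [ffun j => (n j - (j == i))%N] => //.
    apply/ffunP => j; rewrite !ffunE subnK //.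
    by case: eqP => // ->.
apply: eq_esum => n _; congr EFin.
rewrite ffunE eqxx addn1 mulrAC array_weight_incr.
by rewrite -!mulrA [f _ * _]mulrC.
Qed.

(** Invariance under [incr i] says that [f] does not depend on coordinate [i], so the count and [f]
    decouple. *)
Lemma array_mean_mecke_inv i f : (forall n, 0 <= f n) ->
  (forall n, f (incr i n) = f n) ->
  array_mean (fun n => (n i)%:R * f n) = ((rho i)%:E * array_mean f)%E.
Proof. by move=> f0 fi; rewrite array_mean_mecke //; under eq_fun do rewrite fi. Qed.

End PoissonArrays.

(** * Moments of Poisson arrays, derived from void probabilities *)

Section PoissonMoments.
Context {R : realType} {I : finType} (rho : I -> R).
Hypothesis rho_ge0 : forall i, 0 <= rho i.
Hypothesis void_prob : forall S : pred I,
  array_mean rho (fun n => [forall (i | S i), n i == 0%N]%:R) =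
  (expR (- \sum_(i | S i) rho i))%:E.
Local Notation mean := (array_mean rho).

(** The total mass is the void probability of the empty set of indices, so no exponential series is
    summed. *)
Lemma array_mean1 : mean (fun=> 1) = 1%E.
Proof.
have := void_prob pred0; rewrite big_pred0 // oppr0 expR0 => <-.
apply: eq_array_mean => n.
by have -> : [forall (i | @pred0 I i), n i == 0%N] by apply/forallP.
Qed.

Lemma nonvoid_prob (S : pred I) :
  mean (fun n => [exists (i | S i), (0 < n i)%N]%:R) =
  (1 - expR (- \sum_(i | S i) rho i))%:E.
Proof.
have : (mean (fun n => [exists (i | S i), (0 < n i)%N]%:R) +
        mean (fun n => [forall (i | S i), n i == 0%N]%:R) = 1)%E.
  rewrite -array_meanD // -array_mean1; apply: eq_array_mean => n.
  have -> : [exists (i | S i), (0 < n i)%N] = ~~ [forall (i | S i), n i == 0%N].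
    by rewrite negb_forall; apply: eq_existsb => i; rewrite negb_imply lt0n.
  by case: [forall (_ | _), _]; rewrite ?addr0 ?add0r.
rewrite void_prob => E; rewrite EFinB -E addeK //.
Qed.

(** Mecke's formula turns the second factor [N_i] into [N_i + 1]; a second application to this
    remaining count gives [rho_i + 1]. *)
Lemma array_mean_sq i f (x : R) : (forall n, 0 <= f n) ->
  (forall n, f (incr i n) = f n) -> mean f = x%:E ->
  mean (fun n => (n i)%:R * ((n i)%:R * f n)) = (rho i * (rho i + 1) * x)%:E.
Proof.
move=> f0 fi fx; rewrite array_mean_mecke //; last by move=> n; rewrite mulr_ge0.
rewrite (@eq_array_mean _ _ _ _ (fun n => (n i)%:R * f n + f n)); last first.
  by move=> n; rewrite fi ffunE eqxx natrD mulrDl mul1r.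
rewrite array_meanD //; last by move=> n; rewrite mulr_ge0.
rewrite array_mean_mecke_inv // !fx -!EFinM; congr EFin; rewrite /=; ring.
Qed.

End PoissonMoments.

(** * The means that enter the GPS and SCPF delays *)

Section Slices.
Context {R : realType} {B V : finType} (rho : B -> V -> R) (s : V -> R).
Let rho2 (p : B * V) : R := rho p.1 p.2.
Hypothesis rho_ge0 : forall b w, 0 <= rho b w.
Hypothesis load_gt0 : forall w, 0 < overall_load rho w.
Hypothesis s_gt0 : forall w, 0 < s w.
Hypothesis s_sum1 : \sum_w s w = 1.
Hypothesis void_prob : forall S : pred (B * V),
  array_mean rho2 (fun n => [forall (i | S i), n i == 0%N]%:R) =
  (expR (- \sum_(i | S i) rho2 i))%:E.
Local Notation mean := (array_mean rho2).
Implicit Type n : {ffun B * V -> nat}.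

Let rho2_ge0 p : 0 <= rho2 p. Proof. exact: rho_ge0. Qed.

Definition counts n b w : nat := n (b, w).

Lemma slice_count_incr n b v w :
  slice_count (counts (incr (b, v) n)) w = (slice_count (counts n) w + (w == v))%N.
Proof.
rewrite /slice_count /counts.
under eq_bigr do rewrite ffunE; rewrite big_split /=; congr addn.
rewrite (bigD1 b) //= xpair_eqE eqxx /= big1 ?addn0 // => b' /negPf b'b.
by rewrite xpair_eqE b'b.
Qed.

Lemma customer_prob b w : mean (fun n => (0 < n (b, w))%N%:R) = (1 - expR (- rho b w))%:E.
Proof.
have := nonvoid_prob void_prob (pred1 (b, w)).
rewrite big_pred1_eq => <-; apply: eq_array_mean => n.
by congr (_%:R); congr nat_of_bool; apply/idP/existsP => [nb|[p /andP[/eqP ->]]//];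
  exists (b, w); rewrite /= eqxx.
Qed.

(** A slice is absent exactly when all its counts vanish, which is a void event. *)
Lemma slice_prob w :
  mean (fun n => (0 < slice_count (counts n) w)%N%:R) = (1 - expR (- overall_load rho w))%:E.
Proof.
have := nonvoid_prob void_prob [pred p | p.2 == w].
rewrite (_ : \sum_(_ | _) _ = overall_load rho w); last first.
  rewrite /overall_load -(pair_big_dep xpredT (fun _ w' => w' == w) rho) /=.
  by apply: eq_bigr => b _; rewrite big_pred1_eq.
move=> <-; apply: eq_array_mean => n; congr (nat_of_bool _)%:R.
rewrite lt0n sum_nat_eq0 negb_forall; apply/existsP/existsP => [[b nb]|[[b w']]].
  by exists (b, w); rewrite /= eqxx lt0n.
by move=> /andP[/= /eqP -> nb]; exists b; rewrite -lt0n.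
Qed.

(* The two sides of [sum_b E[N_b / N] = P(N > 0)] are computed by Mecke's
   formula, so that the law of the total count [N] is never needed. *)
Lemma mean_inv_slice_count w :
  mean (fun n => (slice_count (counts n) w).+1%:R^-1) =
  ((1 - expR (- overall_load rho w)) / overall_load rho w)%:E.
Proof.
set M := mean _.
have : ((overall_load rho w)%:E * M = (1 - expR (- overall_load rho w))%:E)%E.
  rewrite -slice_prob /overall_load -sumEFin ge0_sume_distrl; last first.
    by move=> b _; rewrite lee_fin.
  rewrite (@eq_array_mean _ _ _ _ (fun n => \sum_b
      ((n (b, w))%:R * (slice_count (counts n) w)%:R^-1))); last first.
    move=> n; rewrite -mulr_suml -natr_sum -/(counts n).
    (* At a zero total both sides are 0, the inverse of 0 being 0. *)
    have [->|N0] := eqVneq (slice_count (counts n) w) 0%N; first by rewrite invr0 mulr0.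
    by rewrite lt0n N0 mulfV // pnatr_eq0.
  rewrite array_mean_sum //; apply: eq_bigr => b _.
  rewrite array_mean_mecke //; congr (_ * _)%E; apply: eq_array_mean => n.
  by rewrite slice_count_incr eqxx addn1.
move=> E; have rw0 := lt0r_neq0 (load_gt0 w).
rewrite mulrC EFinM -E muleA -EFinM mulVf // mul1e //.
Qed.

Lemma mean_slice_fraction b w :
  mean (fun n => (n (b, w))%:R / (slice_count (counts n) w)%:R) =
  (relative_load rho b w * (1 - expR (- overall_load rho w)))%:E.
Proof.
rewrite array_mean_mecke //.
under eq_fun do rewrite slice_count_incr eqxx addn1.
by rewrite mean_inv_slice_count -EFinM /relative_load /rho2 /=; congr EFin; ring.
Qed.

(** One factor [N_b^v] counts the customers, the other comes from the rate. Where they are nonzero,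
    slice [v] is present at [b], so its own indicator may be replaced by 1; the other indicators do
    not involve [N_b^v], and [array_mean_sq] applies to each term. *)
Lemma gps_mean b v :
  mean (fun n => (n (b, v))%:R *
    ((n (b, v))%:R * \sum_(w | (0 < n (b, w))%N) s w)) =
  (rho b v * (rho b v + 1) * (1 - s_bar s rho v b))%:E.
Proof.
rewrite (@eq_array_mean _ _ _ _ (fun n => \sum_w s w *
    ((n (b, v))%:R * ((n (b, v))%:R * (if w == v then 1 else (0 < n (b, w))%N%:R))))); last first.
  move=> n; rewrite [\sum_(_ | _) _]big_mkcond /= !mulr_sumr; apply: eq_bigr => w _.
  case: eqP => [->|_]; last by case: ltnP => _ /=; ring.
  by case: ltnP => [_|]; [ring|rewrite leqn0 => /eqP ->; rewrite !mul0r mulr0].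
have if_ge0 n w : 0 <= (if w == v then 1 else (0 < n (b, w))%N%:R) :> R by case: ifP.
rewrite array_mean_sum; last by move=> w n; rewrite !mulr_ge0 // ltW.
under eq_bigr => w _.
  rewrite array_meanZ ?(ltW (s_gt0 w)) //; last by move=> n; rewrite !mulr_ge0.
  rewrite (@array_mean_sq _ _ _ _ _ _ (if w == v then 1 else 1 - expR (- rho b w))) //; last 2 first.
  - move=> n; case: eqP => // /eqP /negPf wv.
    by rewrite ffunE xpair_eqE eqxx wv addn0.
  - by case: eqP => _; [rewrite (array_mean1 void_prob)|exact: customer_prob].
  rewrite -EFinM; over.
rewrite sumEFin; congr EFin.
(* Since the shares sum to 1, [1 - s_bar] weights [v] by 1 and every other slice by its probability
   of presence at [b]. *)
have -> : 1 - s_bar s rho v b = s v + \sum_(w | w != v) s w * (1 - expR (- rho b w)).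
  rewrite -{1}s_sum1 (bigD1 v) //= -addrA -sumrB; congr (_ + _).
  by apply: eq_bigr => w _; rewrite mulrBr mulr1.
rewrite (bigD1 v) //= eqxx [RHS]mulrDr mulr_sumr; congr (_ + _).
  by rewrite /rho2 /=; ring.
by apply: eq_bigr => w /negPf ->; rewrite /rho2 /=; ring.
Qed.

(** Mecke's formula at [(b, v)] turns [N^v] into [N^v + 1]; applied again to each count in [N^v], it
    gives [rho^v + 1], as [f] involves no count of slice [v]. *)
Lemma mean_count_slice_count b v f (x : R) : (forall n, 0 <= f n) ->
  (forall n b', f (incr (b', v) n) = f n) -> mean f = x%:E ->
  mean (fun n => (n (b, v))%:R * ((slice_count (counts n) v)%:R * f n)) =
  (rho b v * (overall_load rho v + 1) * x)%:E.
Proof.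
move=> f0 fi fx; rewrite array_mean_mecke //; last by move=> n; rewrite mulr_ge0.
rewrite (@eq_array_mean _ _ _ _ (fun n => \sum_b' (n (b', v))%:R * f n + f n)); last first.
  move=> n; rewrite fi slice_count_incr eqxx natrD mulrDl mul1r.
  by rewrite -mulr_suml -natr_sum.
rewrite array_meanD //; last by move=> n; apply: sumr_ge0 => b' _; rewrite mulr_ge0.
rewrite array_mean_sum; last by move=> b' n; rewrite mulr_ge0.
under eq_bigr do rewrite array_mean_mecke_inv // fx -EFinM.
rewrite sumEFin !fx -EFinD -EFinM; congr EFin.
by rewrite -mulr_suml /rho2 /= -/(overall_load rho v); ring.
Qed.

(** In the term of slice [v] itself [N^v] cancels and the square of [N_b^v] remains. In the others
    [N_b^w / N^w] involves no count of slice [v], so its mean factors out. *)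
Lemma scpf_mean b v :
  mean (fun n => (n (b, v))%:R * ((slice_count (counts n) v)%:R *
    \sum_(w | (0 < slice_count (counts n) w)%N)
       (n (b, w))%:R * s w / (slice_count (counts n) w)%:R)) =
  (s v * (rho b v * (rho b v + 1)) + rho b v * (overall_load rho v + 1) *
    \sum_(w | w != v) s w * (relative_load rho b w * (1 - expR (- overall_load rho w))))%:E.
Proof.
rewrite (@eq_array_mean _ _ _ _ (fun n => \sum_w s w * ((n (b, v))%:R *
    (if w == v then (n (b, v))%:R * 1 else (slice_count (counts n) v)%:R *
       ((n (b, w))%:R / (slice_count (counts n) w)%:R))))); last first.
  move=> n; rewrite [\sum_(_ | _) _]big_mkcond /= !mulr_sumr; apply: eq_bigr => w _.
  have [->|wv] := eqVneq w v.
    case: ltnP => [N0|].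
      have {}N0 : (slice_count (counts n) v)%:R != 0 :> R by rewrite pnatr_eq0 -lt0n.
      by field.
    (* A zero total forces [N_b^v = 0], so both sides vanish although slice [v] is then left out of
       the sum. *)
    rewrite leqn0 sum_nat_eq0 => /forallP /(_ b); rewrite /counts => /eqP ->.
    by rewrite !mul0r mulr0.
  case: ltnP => [_|]; first by ring.
  by rewrite leqn0 => /eqP ->; rewrite invr0 !mulr0.
rewrite array_mean_sum; last first.
  by move=> w n; rewrite mulr_ge0 ?(ltW (s_gt0 w)) // mulr_ge0 //; case: ifP => _;
    rewrite !mulr_ge0 // ?invr_ge0.
rewrite (bigD1 v) //= eqxx array_meanZ ?(ltW (s_gt0 v)) //.
rewrite (@array_mean_sq _ _ _ _ _ _ 1) ?array_mean1 //.
under eq_bigr => w wv.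
  rewrite array_meanZ ?(ltW (s_gt0 w)) //; last first.
    by move=> n; rewrite (negPf wv) !mulr_ge0 // invr_ge0.
  rewrite (negPf wv) (@mean_count_slice_count _ _ _ (relative_load rho b w *
    (1 - expR (- overall_load rho w)))) ?mean_slice_fraction //; last first.
    by move=> n b'; rewrite slice_count_incr ffunE xpair_eqE (negPf wv) andbF !addn0.
  rewrite -EFinM; over.
rewrite sumEFin -EFinM -EFinD; congr EFin; congr (_ + _); first by rewrite mulr1.
by rewrite mulr_sumr; apply: eq_bigr => w _; ring.
Qed.

End Slices.

(** * From the probability space to means over arrays *)

Section Model.
Context {R : realType} {B V : finType} (rho delta : B -> V -> R)
  (M : slicing_system R B V).
Hypothesis rho_ge0 : forall b w, 0 <= rho b w.
Hypothesis model : slicing_model rho delta M.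
Let P := sample_prob M.
Let rho2 (p : B * V) : R := rho p.1 p.2.
Implicit Types (p : B * V) (n : {ffun B * V -> nat}).

Definition count_array (omega : sample_space M) : {ffun B * V -> nat} :=
  [ffun p => customers M p.1 p.2 omega].

Definition count_event n p : set (sample_space M) :=
  customers M p.1 p.2 @^-1` [set n p].

Lemma measurable_count_event n p : measurable (count_event n p).
Proof. by rewrite /count_event; exact: measurable_funPTI. Qed.

Lemma count_event_system n p : system_events (inl p) (count_event n p).
Proof. by case: p => b w /=; exists [set n (b, w)] => //; rewrite setTI. Qed.

Lemma count_prob n p : P (count_event n p) = (poisson_weight (rho2 p) (n p))%:E.
Proof.
transitivity (distribution P (customers M p.1 p.2) [set n p]); first by [].
rewrite (count_poisson model) /poisson_prob /poisson_weight -/(rho2 p).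
case: ifP => r0; first by rewrite esum_set1 // lee_fin poisson_pmf_ge0.
rewrite diracE; congr ((nat_of_bool _)%:R%:E); apply/idP/idP => [|/eqP ->].
  by rewrite inE => /= <-.
by rewrite inE.
Qed.

Lemma counts_prob (S : seq (B * V)) n : uniq S ->
  P (\big[setI/setT]_(p <- S) count_event n p) =
  (\prod_(p <- S) poisson_weight (rho2 p) (n p))%:E.
Proof.
move=> uS; pose E (i : (B * V) + (B * V * nat)) := if i is inl p then count_event n p else setT.
have := @system_independent _ _ _ _ _ _ model (map inl S) E.
rewrite (map_inj_uniq (@inl_inj _ _)) !big_map => -> //; last first.
  by move=> _ /mapP[p _ ->]; exact: count_event_system.
rewrite (big_morph EFin (@EFinM R) erefl).
by apply: eq_bigr => p _; exact: count_prob.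
Qed.

Lemma count_array_preimage n :
  count_array @^-1` [set n] = \big[setI/setT]_(p : B * V) count_event n p.
Proof.
rewrite -bigcap_seq; apply/seteqP; split => [x /= <- p _|x nx].
  by rewrite /count_event /= ffunE.
by apply/ffunP => p; rewrite ffunE; by apply: (nx p); rewrite /= mem_index_enum.
Qed.

Lemma measurable_count_array n : measurable (count_array @^-1` [set n]).
Proof.
by rewrite count_array_preimage; apply: bigsetI_measurable => p _;
  exact: measurable_count_event.
Qed.

Lemma count_array_prob n :
  P (count_array @^-1` [set n]) = (array_weight rho2 n)%:E.
Proof. by rewrite count_array_preimage counts_prob // index_enum_uniq. Qed.

(** The product rule is applied to the subfamily made of one peak rate and all the counts, whose
    events intersect in [count_array = n]. *)
Lemma count_array_peak_indep n b w k (E : set R) : measurable E ->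
  P (count_array @^-1` [set n] `&` peak_rate M b w k @^-1` E) =
  (P (count_array @^-1` [set n]) * P (peak_rate M b w k @^-1` E))%E.
Proof.
move=> mE; rewrite setIC muleC count_array_prob.
pose F (i : (B * V) + (B * V * nat)) := match i with inl p => count_event n p
                       | inr _ => peak_rate M b w k @^-1` E end.
pose J : seq ((B * V) + (B * V * nat)) :=
  inr (b, w, k) :: map inl (index_enum (B * V)%type).
have := @system_independent _ _ _ _ _ _ model J F.
rewrite /J !big_cons !big_map -count_array_preimage => -> /=; last 2 first.
- rewrite (map_inj_uniq (@inl_inj _ _)) index_enum_uniq andbT.
  by apply/mapP => -[].
- move=> i; rewrite inE => /predU1P[->|/mapP[p _ ->]].
    by exists E => //; rewrite setTI.
  exact: count_event_system.
congr (_ * _)%E.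
rewrite /array_weight (big_morph EFin (@EFinM R) erefl).
by apply: eq_bigr => p _; exact: count_prob.
Qed.

Lemma expectation_counts (g : {ffun B * V -> nat} -> R) : (forall n, 0 <= g n) ->
  (\int[P]_x (g (count_array x))%:E)%E = array_mean rho2 g.
Proof.
move=> g0.
rewrite (@ge0_integral_countable _ _ _ P _ count_array) //.
- apply: eq_esum => n _.
  rewrite (@eq_integral _ _ _ _ _ (cst (g n)%:E)); last by move=> x; rewrite inE => /= ->.
  rewrite integral_cst; last exact: measurable_count_array.
  by rewrite EFinM -count_array_prob.
- exact: measurable_count_array.
- move=> n; apply: (@eq_measurable_fun _ _ _ _ _ (cst (g n)%:E)) => //.
  by move=> x; rewrite inE => /= ->.
- by move=> x; rewrite lee_fin.
Qed.

(** This discharges the hypothesis of the same name in the sections on moments. On the sample space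
    it is the probability of an intersection of independent events, so no sum over arrays is
    evaluated. *)
Lemma void_prob (S : pred (B * V)) :
  array_mean rho2 (fun n => [forall (p | S p), n p == 0%N]%:R) =
  (expR (- \sum_(p | S p) rho2 p))%:E.
Proof.
rewrite -expectation_counts //.
pose A := \big[setI/setT]_(p <- enum S) count_event [ffun=> 0%N] p.
have mA : measurable A.
  by apply: bigsetI_measurable => p _; exact: measurable_count_event.
transitivity (\int[P]_x (\1_A x)%:E)%E.
  apply: eq_integral => x _; rewrite indicE; congr ((nat_of_bool _)%:R%:E).
  rewrite /A -bigcap_seq.
  apply/forallP/idP => [H|]; rewrite inE.
    move=> p /=; rewrite mem_enum => Sp; have := H p.
    by rewrite /count_event /= !ffunE => /implyP /(_ Sp) /eqP.
  move=> H p; apply/implyP => Sp; rewrite ffunE; apply/eqP.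
  by have := H p; rewrite /count_event /= mem_enum ffunE; apply.
rewrite integral_indic // setIT.
apply: etrans (counts_prob _ (enum_uniq S)) _; rewrite big_enum /=.
congr EFin; rewrite -sumrN expR_sum; apply: eq_bigr => p _.
rewrite ffunE /poisson_weight /poisson_pmf; case: ltP => [_|r0].
  by rewrite expr0 fact0 invr1 !mul1r.
(* A zero mean falls in the Dirac case, where the weight 1 is again [expR 0]. *)
have -> : rho2 p = 0 by apply/le_anti; rewrite r0 /rho2 rho_ge0.
by rewrite oppr0 expR0.
Qed.

(** Common to both disciplines, [F] being the reciprocal rate at unit peak rate. On
    [count_array = n] the number of customers is fixed, and each reciprocal peak rate, independent
    of this event, contributes [delta b v]; the [n (b, v)] equal contributions give the weight. *)
Lemma expectation_inv_rate (rate : (B -> V -> nat) -> B -> V -> R -> R)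
    (F : (B -> V -> nat) -> B -> R) (v : V) :
  (forall m b c, (rate m b v c)^-1 = F m b * c^-1) -> (forall m b, 0 <= F m b) ->
  (forall b, 0 <= delta b v) ->
  ('E_P[fun omega => (\sum_b \sum_(k < customers M b v omega)
         (rate (fun b' w => customers M b' w omega) b v
               (peak_rate M b v k omega))^-1)%R] =
   \sum_b (delta b v)%:E *
     array_mean rho2 (fun n => (n (b, v))%:R * F (counts n) b)%R)%E.
Proof.
move=> rateE F0 delta_ge0.
(* The absolute value makes [h] nonnegative on the whole line; at positive peak rates it is plain
   inversion. *)
pose h (x : R) := `|x^-1|%:E.
have mh : measurable_fun setT h.
  apply/measurable_EFinP; apply: measurableT_comp => //.
  exact: measurable_fun_invr.
have h0 x : (0 <= h x)%E by rewrite lee_fin.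
have mhpeak n b k :
    measurable_fun (count_array @^-1` [set n]) (fun x => h (peak_rate M b v k x)).
  apply: (@measurable_funS _ _ _ _ setT) => //.
  by apply: measurableT_comp.
have intpeak n b k : (\int[P]_(x in count_array @^-1` [set n]) h (peak_rate M b v k x) =
    (array_weight rho2 n * delta b v)%:E)%E.
  rewrite ge0_integral_indep //; last 2 first.
  - exact: measurable_count_array.
  - by move=> E mE; exact: count_array_peak_indep.
  rewrite count_array_prob EFinM -(mean_reciprocal_capacity model).
  rewrite -(expectation_inv_eq_law (peak_law model b v k)) unlock.
  congr (_ * _)%E; apply: eq_integral => x _.
  by rewrite /h ger0_norm // invr_ge0 ltW // (peak_gt0 model).
pose f n x := (\sum_b \sum_(k < n (b, v)) (F (counts n) b)%:E * h (peak_rate M b v k x))%E.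
have fE n x : count_array x = n -> ((\sum_b \sum_(k < customers M b v x)
    (rate (fun b' w => customers M b' w x) b v (peak_rate M b v k x))^-1)%R)%:E = f n x.
  move=> xn; have cn : (fun b' w => customers M b' w x) = counts n.
    by apply/funext => b'; apply/funext => w; rewrite /counts -xn ffunE.
  rewrite /f -sumEFin; apply: eq_bigr => b _.
  rewrite -[customers M b v x]/((fun b' w => customers M b' w x) b v) cn.
  rewrite -sumEFin; apply: eq_bigr => k _.
  by rewrite rateE EFinM /h ger0_norm // invr_ge0 ltW // (peak_gt0 model).
have mterm n b k : measurable_fun (count_array @^-1` [set n])
    (fun x => (F (counts n) b)%:E * h (peak_rate M b v k x))%E.
  by apply: emeasurable_funM.
have term_ge0 n b k x : (0 <= (F (counts n) b)%:E * h (peak_rate M b v k x))%E.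
  by rewrite mule_ge0 // lee_fin.
rewrite unlock (@ge0_integral_countable _ _ _ P _ count_array) //; last 3 first.
- exact: measurable_count_array.
- move=> n; apply: (@eq_measurable_fun _ _ _ _ _ (f n)).
    by move=> x; rewrite inE => /fE ->.
  by apply: emeasurable_sum => b; apply: emeasurable_sum => k.
- move=> x; rewrite (fE _ _ erefl) /f.
  by apply: sume_ge0 => b _; apply: sume_ge0 => k _.
transitivity (\esum_(n in [set: {ffun B * V -> nat}])
    \sum_b (delta b v)%:E * ((n (b, v))%:R * F (counts n) b * array_weight rho2 n)%:E)%E.
  apply: eq_esum => n _.
  rewrite (@eq_integral _ _ _ _ _ (f n)); last by move=> x; rewrite inE => /fE.
  rewrite ge0_integral_sum //; last 3 first.
  - exact: measurable_count_array.
  - by move=> b; apply: emeasurable_sum.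
  - by move=> b x _; apply: sume_ge0.
  apply: eq_bigr => b _.
  rewrite ge0_integral_sum //; last exact: measurable_count_array.
  under eq_bigr => k _.
    rewrite ge0_integralZl //; [|exact: measurable_count_array|by rewrite lee_fin].
    rewrite intpeak -EFinM; over.
  rewrite sumEFin -EFinM sumr_const card_ord -[RHS]/(_%:E); congr EFin.
  by rewrite -mulr_natl; ring.
rewrite esum_sum; last first.
  move=> n b _ _; rewrite -EFinM lee_fin mulr_ge0 // mulr_ge0 ?array_weight_ge0 //.
  by rewrite mulr_ge0.
apply: eq_bigr => b _; rewrite ge0_esumZl // => n.
by rewrite lee_fin mulr_ge0 ?array_weight_ge0 // mulr_ge0.
Qed.

End Model.

(** * Weighted inner products as sums over base stations *)

Section MatrixSums.
Context {R : realType} {B : finType}.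
Implicit Types (f g x y : B -> R).

Lemma winner_diagE f x y : winner (diag f) (vec x) (vec y) = \sum_b x b * f b * y b.
Proof.
rewrite /winner /diag mul_mx_diag mxE (reindex _ (onW_bij _ (enum_val_bij B))).
by apply: eq_bigr => j _; rewrite !mxE.
Qed.

Lemma inner_vecE x y : inner (vec x) (vec y) = \sum_b x b * y b.
Proof.
rewrite /inner mxE (reindex _ (onW_bij _ (enum_val_bij B))).
by apply: eq_bigr => j _; rewrite !mxE.
Qed.

Lemma mul_diagE f g : diag f *m diag g = diag (fun b => f b * g b).
Proof. by rewrite /diag mulmx_diag; congr diag_mx; apply/rowP => j; rewrite !mxE. Qed.

Lemma const_sub_vec (a : R) x : const_mx a - vec x = vec (fun b => a - x b).
Proof. by apply/colP => j; rewrite !mxE. Qed.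

End MatrixSums.

(** * Closed forms of the delays and of the gains *)

Section Gain.
Context {R : realType} {B V : finType} (s : V -> R) (delta : B -> V -> R) (v : V).
Hypothesis s_gt0 : forall w, 0 < s w.
Hypothesis s_sum1 : \sum_w s w = 1.
Hypothesis delta_gt0 : forall b w, 0 < delta b w.
Implicit Types (q rho : B -> V -> R) (a c : R) (e : V -> R) (sigma : B -> R).

(* All the gains of the corollary are quotients of these two sums, homogeneous
   in [(a, c)]: the exact gain has [(a, c) = (rho^v, 1)], the light-load gain
   [(0, 1)] and the heavy-load gain [(1, 0)]; [e w] stands for [exp (- rho^w)]. *)
Definition gain_num q a c sigma : R :=
  \sum_b delta b v * q b v * ((a * q b v + c) * (1 - sigma b)).

Definition gain_den q a c e : R :=
  \sum_b delta b v * q b v *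
    (s v * (a * q b v + c) + (a + c) * \sum_(w | w != v) s w * (1 - e w) * q b w).

Lemma gain_numZ k q a c sigma :
  gain_num q (k * a) (k * c) sigma = k * gain_num q a c sigma.
Proof. by rewrite /gain_num mulr_sumr; apply: eq_bigr => b _; ring. Qed.

Lemma gain_denZ k q a c e : gain_den q (k * a) (k * c) e = k * gain_den q a c e.
Proof. by rewrite /gain_den mulr_sumr; apply: eq_bigr => b _; ring. Qed.

(** All terms are nonnegative, so a zero sum would make each of them zero, hence each [q b v],
    against their positive sum. The hypotheses on [(a, c)] cover the exact, light-load and
    heavy-load cases. *)
Lemma gain_den_gt0 q a c e : (forall b w, 0 <= q b w) -> 0 < \sum_b q b v ->
  0 <= a -> 0 <= c -> 0 < a + c -> (forall w, e w <= 1) -> 0 < gain_den q a c e.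
Proof.
move=> q0 qv a0 c0 ac e1.
have den0 b : 0 <= delta b v * q b v * (s v * (a * q b v + c) +
    (a + c) * \sum_(w | w != v) s w * (1 - e w) * q b w).
  rewrite !mulr_ge0 ?(ltW (delta_gt0 _ _)) // addr_ge0 //.
    by rewrite mulr_ge0 ?(ltW (s_gt0 _)) // addr_ge0 // mulr_ge0.
  rewrite mulr_ge0 ?(ltW ac) // sumr_ge0 // => w _.
  by rewrite !mulr_ge0 ?(ltW (s_gt0 _)) // subr_ge0.
rewrite lt_neqAle sumr_ge0 // andbT eq_sym; apply/negP => /eqP.
move/(psumr_eq0P (fun b _ => den0 b)) => H.
move: qv; rewrite big1 ?ltxx // => b _; apply/eqP; apply: contraT => qb.
have {}qb : 0 < q b v by rewrite lt_neqAle eq_sym qb q0.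
have := H b isT; move/eqP; rewrite gt_eqF // !mulr_gt0 //.
rewrite ltr_pwDl //.
  (* If [a = 0], then [c = a + c] is positive; otherwise [a * q b v] is. *)
  rewrite mulr_gt0 //; move: a0; rewrite le_eqVlt => /predU1P[a0|a0].
    by move: ac; rewrite -a0 mul0r.
  by rewrite ltr_wpDr // mulr_gt0.
rewrite mulr_ge0 ?(ltW ac) // sumr_ge0 // => w _.
by rewrite !mulr_ge0 ?(ltW (s_gt0 _)) // subr_ge0.
Qed.

Lemma gain_formulaE rho : gain_formula s delta rho v =
  gain_num (relative_load rho) (overall_load rho v) 1 (s_bar s rho v) /
  gain_den (relative_load rho) (overall_load rho v) 1 (fun w => expR (- overall_load rho w)).
Proof.
rewrite /gain_formula /= /wsqnorm mul_diagE const_sub_vec !winner_diagE inner_vecE.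
congr (_ / _).
  rewrite -sumrB mulr_sumr -big_split /=; apply: eq_bigr => b _; ring.
rewrite !mulr_sumr -sumrB -big_split /=; apply: eq_bigr => b _.
(* The exponential of [v]'s own load cancels: its term in [g'] and the subtracted squared norm
   combine into [s v * rho^v * q b v]. *)
rewrite /g_tilde' (bigD1 v) //=; ring.
Qed.

Lemma gain_lightE r q :
  gain_light s delta r q v =
  gain_num q 0 1 (s_bar s (load_of r q) v) / gain_den q 0 1 (fun w => expR (- r w)).
Proof.
rewrite /gain_light /= const_sub_vec !winner_diagE inner_vecE.
congr (_ / _); first by apply: eq_bigr => b _; ring.
rewrite mulr_sumr -big_split /=; apply: eq_bigr => b _.
(* At load 0 slice [v] has no share in [g'], as [1 - expR 0 = 0]. *)
rewrite /g_tilde' (bigD1 v) //= /set_load eqxx oppr0 expR0 subrr.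
rewrite (eq_bigr (fun w => s w * (1 - expR (- r w)) * q b w)); last first.
  by move=> w /negPf ->.
ring.
Qed.

Lemma gain_heavyE q sigma : gain_heavy s delta q sigma v =
  gain_num q 1 0 sigma / gain_den q 1 0 (fun=> 0).
Proof.
rewrite /gain_heavy /= /wsqnorm mul_diagE !winner_diagE.
congr (_ / _).
  by rewrite -sumrB; apply: eq_bigr => b _; ring.
apply: eq_bigr => b _; rewrite /g_tilde (bigD1 v) //=.
rewrite [in RHS](eq_bigr (fun w => s w * q b w)); first by ring.
by move=> w _; ring.
Qed.

(** The prefactor [1 / rho^v] turns [rho_b^v (rho_b^v + 1)] into [q_b^v (rho^v q_b^v + 1)], whence
    the coefficients [(rho^v, 1)]. *)
Lemma mean_btd_gps rho (M : slicing_system R B V) :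
  (forall b w, 0 <= rho b w) -> (forall w, 0 < overall_load rho w) ->
  slicing_model rho delta M ->
  mean_btd (rate_gps s) rho M v =
  ((s v)^-1 * gain_num (relative_load rho) (overall_load rho v) 1 (s_bar s rho v))%:E.
Proof.
move=> rho0 load0 model; have rv0 := lt0r_neq0 (load0 v).
rewrite /mean_btd (expectation_inv_rate model (F := fun m b =>
   (s v)^-1 * ((m b v)%:R * \sum_(w | (0 < m b w)%N) s w))); last 3 first.
- by move=> m b c; rewrite /rate_gps !invfM !invrK; ring.
- move=> m b; rewrite mulr_ge0 ?invr_ge0 ?(ltW (s_gt0 _)) // mulr_ge0 // sumr_ge0 // => w _.
  exact: ltW.
- by move=> b; exact: ltW.
under eq_bigr => b _.
  under eq_array_mean do rewrite mulrCA /counts.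
  rewrite array_meanZ ?invr_ge0 ?(ltW (s_gt0 _)) //; last first.
    by move=> n; rewrite !mulr_ge0 // sumr_ge0 // => w _; exact: ltW.
  rewrite (gps_mean rho0 s_gt0 s_sum1 (void_prob rho0 model)) -!EFinM; over.
rewrite sumEFin -EFinM; congr EFin; rewrite /gain_num !mulr_sumr.
apply: eq_bigr => b _; rewrite /relative_load; field.
by rewrite rv0 (lt0r_neq0 (s_gt0 v)).
Qed.

Lemma mean_btd_scpf rho (M : slicing_system R B V) :
  (forall b w, 0 <= rho b w) -> (forall w, 0 < overall_load rho w) ->
  slicing_model rho delta M ->
  mean_btd (rate_scpf s) rho M v =
  ((s v)^-1 * gain_den (relative_load rho) (overall_load rho v) 1
     (fun w => expR (- overall_load rho w)))%:E.
Proof.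
move=> rho0 load0 model; have rv0 := lt0r_neq0 (load0 v).
rewrite /mean_btd (expectation_inv_rate model (F := fun m b =>
   (s v)^-1 * ((slice_count m v)%:R * \sum_(w | (0 < slice_count m w)%N)
       (m b w)%:R * s w / (slice_count m w)%:R))); last 3 first.
- by move=> m b c; rewrite /rate_scpf !invfM !invrK; ring.
- move=> m b; rewrite mulr_ge0 ?invr_ge0 ?(ltW (s_gt0 _)) // mulr_ge0 // sumr_ge0 // => w _.
  by rewrite !mulr_ge0 ?invr_ge0 // ltW.
- by move=> b; exact: ltW.
under eq_bigr => b _.
  under eq_array_mean do rewrite mulrCA {2}/counts.
  rewrite array_meanZ ?invr_ge0 ?(ltW (s_gt0 _)) //; last first.
    move=> n; rewrite !mulr_ge0 // sumr_ge0 // => w _.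
    by rewrite !mulr_ge0 ?invr_ge0 // ltW.
  rewrite (scpf_mean rho0 load0 s_gt0 (void_prob rho0 model)) -!EFinM; over.
rewrite sumEFin -EFinM; congr EFin; rewrite /gain_den !mulr_sumr.
apply: eq_bigr => b _.
rewrite (eq_bigr (fun w => s w * (1 - expR (- overall_load rho w)) * relative_load rho b w));
  last by move=> w _; ring.
rewrite /relative_load; field.
by rewrite rv0 (lt0r_neq0 (s_gt0 v)).
Qed.

Lemma btd_gainE rho (M : slicing_system R B V) :
  (forall b w, 0 <= rho b w) -> (forall w, 0 < overall_load rho w) ->
  slicing_model rho delta M ->
  btd_gain s rho M v = (gain_formula s delta rho v)%:E.
Proof.
move=> rho0 load0 model.
rewrite /btd_gain mean_btd_gps // mean_btd_scpf // gain_formulaE.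
set D := gain_den _ _ _ _.
have D0 : 0 < D.
  apply: gain_den_gt0 => //.
  - by move=> b w; rewrite divr_ge0 // ltW.
  - by rewrite /relative_load -mulr_suml divr_gt0 // load0.
  - exact: ltW.
  - by rewrite addr_gt0.
  - by move=> w; rewrite -expR0 ler_expR oppr_le0 ltW.
(* A nonzero denominator makes the extended real quotient a real one, in which the common factor
   [1 / s v] cancels. *)
have sD : (s v)^-1 * D != 0 by rewrite mulf_neq0 ?invr_eq0 ?lt0r_neq0.
rewrite inver (negPf sD) -EFinM; congr EFin.
by field; rewrite !lt0r_neq0.
Qed.

End Gain.

(** * The filter of simultaneous limits of all the loads *)

Section AllLoads.
Context {R : realType} {V : finType}.

#[global] Instance all_loads_filter (F : set_system R) :
  Filter F -> Filter (@all_loads R V F).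
Proof.
move=> FF; apply: filter_from_filter; first by exists setT; exact: filterT.
move=> A A' FA FA'; exists (A `&` A'); first exact: filterI.
by move=> r rA; split => w; case: (rA w).
Qed.

#[global] Instance all_loads_proper_filter (F : set_system R) :
  ProperFilter F -> ProperFilter (@all_loads R V F).
Proof.
move=> FF; apply: filter_from_proper => A FA.
by have [x Ax] := filter_ex FA; exists (fun=> x).
Qed.

Lemma cvg_all_loads (F : set_system R) (w : V) :
  r w @[r --> all_loads F] --> F.
Proof. by move=> A FA; exists A => // r; exact. Qed.

Lemma near_all_loads (F : set_system R) (A : set R) :
  F A -> \forall r \near all_loads F, forall w : V, A (r w).
Proof. by exists A. Qed.

End AllLoads.

(** * Light-load and heavy-load limits *)

Section Limits.
Context {R : realType} {B V : finType} (s : V -> R) (delta : B -> V -> R) (v : V).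

Lemma eq_gain_den (q : B -> V -> R) (a c : R) (e e' : V -> R) :
  (forall w, w != v -> e w = e' w) ->
  gain_den s delta v q a c e = gain_den s delta v q a c e'.
Proof.
move=> ee; apply: eq_bigr => b _; congr (_ * (_ + _ * _)).
by apply: eq_bigr => w wv; rewrite ee.
Qed.

Lemma cvg_sum (T I : Type) (F : set_system T) (FF : Filter F) (r : seq I)
    (P : pred I) (f : I -> T -> R) (l : I -> R) :
  (forall i, P i -> f i x @[x --> F] --> l i) ->
  \sum_(i <- r | P i) f i x @[x --> F] --> \sum_(i <- r | P i) l i.
Proof. by move=> fl; apply: cvg_big => //; exact: add_continuous. Qed.

(** Numerator and denominator are polynomial in the coefficients, so the quotient passes to the
    limit where the limiting denominator is nonzero. All three limits are instances. *)
Lemma cvg_gain (T : Type) (F : set_system T) (FF : Filter F) (q : B -> V -> R)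
    (a c : T -> R) (e : V -> T -> R) (sigma : B -> T -> R)
    (a0 c0 : R) (e0 : V -> R) (sigma0 : B -> R) :
  a x @[x --> F] --> a0 -> c x @[x --> F] --> c0 ->
  (forall w, w != v -> e w x @[x --> F] --> e0 w) ->
  (forall b, sigma b x @[x --> F] --> sigma0 b) ->
  gain_den s delta v q a0 c0 e0 != 0 ->
  gain_num delta v q (a x) (c x) (sigma^~ x) /
    gain_den s delta v q (a x) (c x) (e^~ x) @[x --> F] -->
  gain_num delta v q a0 c0 sigma0 / gain_den s delta v q a0 c0 e0.
Proof.
move=> al cl el sl den0.
have acl b : a x * q b v + c x @[x --> F] --> a0 * q b v + c0.
  by apply: cvgD => //; apply: cvgM => //; exact: cvg_cst.
apply: cvgM; [|apply: cvgV => //]; apply: cvg_sum => b _; apply: cvgM;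
  try exact: cvg_cst.
  by apply: cvgM => //; apply: cvgB => //; exact: cvg_cst.
apply: cvgD; first by apply: cvgM => //; exact: cvg_cst.
apply: cvgM; first exact: cvgD.
apply: cvg_sum => w wv; apply: cvgM; last exact: cvg_cst.
apply: cvgM; first exact: cvg_cst.
by apply: cvgB; [exact: cvg_cst|exact: el].
Qed.

Lemma cvg_expRN (T : Type) (F : set_system T) (FF : Filter F) (f : T -> R) (l : R) :
  f x @[x --> F] --> l -> expR (- f x) @[x --> F] --> expR (- l).
Proof.
move=> fl; apply: (@continuous_cvg _ _ _ F _ (fun x => - f x) expR).
  exact: continuous_expR.
exact: cvgN.
Qed.

Lemma cvg_s_bar (T : Type) (F : set_system T) (FF : Filter F) (rho : T -> B -> V -> R)
    (b : B) (e0 : V -> R) :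
  (forall w, w != v -> expR (- rho x b w) @[x --> F] --> e0 w) ->
  s_bar s (rho x) v b @[x --> F] --> \sum_(w | w != v) s w * e0 w.
Proof.
move=> el; apply: cvg_sum => w wv; apply: cvgM; first exact: cvg_cst.
exact: el.
Qed.

Hypothesis s_gt0 : forall w, 0 < s w.
Hypothesis s_sum1 : \sum_w s w = 1.
Hypothesis delta_gt0 : forall b w, 0 < delta b w.
Variable q : B -> V -> R.
Hypothesis q_ge0 : forall b w, 0 <= q b w.
Hypothesis q_sum1 : forall w, \sum_b q b w = 1.

Lemma overall_load_of (r : V -> R) : overall_load (load_of r q) = r.
Proof. by apply/funext => w; rewrite /overall_load -mulr_sumr q_sum1 mulr1. Qed.

Lemma relative_load_of (r : V -> R) : (forall w, 0 < r w) ->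
  relative_load (load_of r q) = q.
Proof.
move=> r0; apply/funext => b; apply/funext => w.
by rewrite /relative_load overall_load_of /load_of mulrAC mulfV ?mul1r // lt0r_neq0.
Qed.

Lemma btd_gain_load_of (r : V -> R) (M : slicing_system R B V) :
  (forall w, 0 < r w) -> slicing_model (load_of r q) delta M ->
  btd_gain s (load_of r q) M v =
  (gain_num delta v q (r v) 1 (s_bar s (load_of r q) v) /
   gain_den s delta v q (r v) 1 (fun w => expR (- r w)))%:E.
Proof.
move=> r0 model; rewrite (btd_gainE v s_gt0 s_sum1 delta_gt0 _ _ model).
- by rewrite gain_formulaE overall_load_of relative_load_of.
- by move=> b w; rewrite mulr_ge0 // ltW.
- by move=> w; rewrite overall_load_of.
Qed.

Let den_gt0 a c e : 0 <= a -> 0 <= c -> 0 < a + c -> (forall w, e w <= 1) ->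
  0 < gain_den s delta v q a c e.
Proof. by move=> *; apply: gain_den_gt0 => //; rewrite q_sum1. Qed.

(** The closed form of the gain holds only at positive loads, hence only eventually along the
    filter. *)
Lemma cvg_near_EFin (T : Type) (F : set_system T) (FF : Filter F)
    (f : T -> \bar R) (g : T -> R) (l : R) :
  (\forall x \near F, f x = (g x)%:E) -> g x @[x --> F] --> l ->
  f x @[x --> F] --> l%:E.
Proof.
move=> fg gl.
have gf : {near F, EFin \o g =1 f} by apply: filterS fg => x /= ->.
apply: cvg_trans (near_eq_cvg gf) _.
by apply: cvg_EFin => //; exact: nearW.
Qed.

Lemma cvg_gain_light_load (r : V -> R) (M : (V -> R) -> slicing_system R B V) :
  (forall w, 0 < r w) ->
  (forall r, (forall w, 0 < r w) -> slicing_model (load_of r q) delta (M r)) ->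
  btd_gain s (load_of (set_load r v x) q) (M (set_load r v x)) v
    @[x --> 0^'+] --> (gain_light s delta r q v)%:E.
Proof.
move=> r0 model; rewrite gain_lightE.
apply: (@cvg_near_EFin _ _ _ _ (fun x =>
  gain_num delta v q x 1 (s_bar s (load_of r q) v) /
  gain_den s delta v q x 1 (fun w => expR (- r w)))).
  near=> x; have x0 : 0 < x by near: x; exact: nbhs_right_gt.
  have rx w : 0 < set_load r v x w by rewrite /set_load; case: eqP.
  rewrite btd_gain_load_of //; last exact: model.
  rewrite {1 3}/set_load eqxx; congr ((_ / _)%:E).
    (* [s_bar] ranges over the slices other than [v], so [x] enters only through the coefficient
       [a]. *)
    congr gain_num; apply/funext => b; apply: eq_bigr => w /negPf wv.
    by rewrite /load_of /set_load wv.
  by apply: eq_gain_den => w /negPf wv; rewrite /set_load wv.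
apply: cvg_gain => //.
- exact/cvg_at_right_filter/cvg_id.
- exact: cvg_cst.
- by move=> w _; exact: cvg_cst.
- by move=> b; exact: cvg_cst.
- rewrite gt_eqF // den_gt0 // ?add0r // => w.
  by rewrite -expR0 ler_expR oppr_le0 ltW.
Unshelve. all: by end_near. Qed.

(** When every [e w] is 1 the other slices leave the denominator, and [1 - s_bar] becomes [s v]
    since the shares sum to 1: the two sums agree term by term. *)
Lemma gain_light_cvg1 : gain_light s delta r q v @[r --> all_loads 0^'+] --> (1 : R).
Proof.
under eq_fun do rewrite gain_lightE.
have r0 (w : V) : r w @[r --> all_loads 0^'+] --> (0 : R).
  apply: cvg_trans (cvg_all_loads w) _; exact: cvg_within.
have e0 (w : V) : expR (- r w) @[r --> all_loads 0^'+] --> (1 : R).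
  by rewrite -[X in _ --> X]expR0 -[X in expR X]oppr0; exact: cvg_expRN.
have den1 : gain_den s delta v q 0 1 (fun=> 1) != 0.
  by rewrite gt_eqF // den_gt0 // add0r.
have sv : 1 - \sum_(w | w != v) s w * 1 = s v.
  by under eq_bigr do rewrite mulr1; rewrite -s_sum1 (bigD1 v) //= addrK.
have lim1 : gain_num delta v q 0 1 (fun=> \sum_(w | w != v) s w * 1) /
    gain_den s delta v q 0 1 (fun=> 1) = 1.
  rewrite -[RHS](divff den1); congr (_ / _).
  apply: eq_bigr => b _; rewrite [in RHS]big1; last by move=> w _; rewrite subrr mulr0 mul0r.
  by rewrite sv; ring.
have := @cvg_gain _ _ (all_loads_filter (at_right_proper_filter (0 : R))) q (fun=> 0) (fun=> 1)
  (fun w r => expR (- r w)) (fun b r => s_bar s (load_of r q) v b) 0 1 (fun=> 1)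
  (fun=> \sum_(w | w != v) s w * 1).
rewrite lim1; apply => //; try exact: cvg_cst.
move=> b; apply: cvg_s_bar => w _; rewrite -[X in _ --> X]expR0 -[X in expR X]oppr0.
apply: cvg_expRN; rewrite -[X in _ --> X](mul0r (q b w)).
by apply: cvgM; [exact: r0|exact: cvg_cst].
Qed.

(** The load [r w * q b w] tends to infinity unless [q b w = 0], in which case it stays 0; the
    exponential thus tends to the indicator of [q b w = 0]. *)
Lemma s_bar_heavy_cvg b : s_bar s (load_of r q) v b @[r --> all_loads (pinfty_nbhs R)] -->
  \sum_(w | w != v) s w * (q b w == 0)%:R.
Proof.
apply: cvg_s_bar => w _; rewrite /load_of; have [->|qbw] := eqVneq (q b w) 0.
  by under eq_fun do rewrite mulr0 oppr0 expR0; exact: cvg_cst.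
have {}qbw : 0 < q b w by rewrite lt_neqAle eq_sym qbw q_ge0.
have rq : r w * q b w @[r --> all_loads (pinfty_nbhs R)] --> +oo.
  exact: (cvg_comp _ _ (@cvg_all_loads _ _ _ w) (gt0_cvgMly qbw cvg_id)).
exact: (cvg_comp _ _ rq (@cvgr_expR R)).
Qed.

Lemma cvg_gain_heavy_load (M : (V -> R) -> slicing_system R B V) :
  (forall r, (forall w, 0 < r w) -> slicing_model (load_of r q) delta (M r)) ->
  btd_gain s (load_of r q) (M r) v @[r --> all_loads (pinfty_nbhs R)] -->
  (gain_heavy s delta q (fun b => \sum_(w | w != v) s w * (q b w == 0)%:R) v)%:E.
Proof.
move=> model; rewrite gain_heavyE.
have pos : \forall r \near all_loads (pinfty_nbhs R), forall w : V, 0 < r w.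
  by apply: (near_all_loads (A := [set x | 0 < x])); exact: nbhs_pinfty_gt.
apply: (@cvg_near_EFin _ _ _ _ (fun r =>
  gain_num delta v q 1 (r v)^-1 (s_bar s (load_of r q) v) /
  gain_den s delta v q 1 (r v)^-1 (fun w => expR (- r w)))).
  near=> r; have r0 : forall w, 0 < r w by near: r.
  rewrite btd_gain_load_of //; last exact: model.
  have rv := lt0r_neq0 (r0 v).
  (* By homogeneity the pair [(r v, 1)] is replaced by [(1, (r v)^-1)], which converges to
     [(1, 0)]. *)
  rewrite -[X in gain_num _ _ _ X]mulr1 -[X in gain_den _ _ _ _ X]mulr1.
  rewrite -[X in gain_num _ _ _ _ X](mulfV rv) -[X in gain_den _ _ _ _ _ X](mulfV rv).
  rewrite gain_numZ gain_denZ; congr EFin.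
  rewrite invfM mulrACA mulfV // mul1r //.
apply: cvg_gain.
- exact: cvg_cst.
- apply/gtr0_cvgV0; last exact: cvg_all_loads.
  by apply: filterS pos => r; exact.
- by move=> w _; exact: (cvg_comp _ _ (@cvg_all_loads _ _ _ w) (@cvgr_expR R)).
- exact: s_bar_heavy_cvg.
- by rewrite gt_eqF // den_gt0 // addr0.
Unshelve. all: by end_near. Qed.

End Limits.

Theorem corollary2 (R : realType) (B V : finType)
  (s : V -> R) (s_gt0 : forall w, 0 < s w) (s_sum1 : \sum_w s w = 1)
  (delta : B -> V -> R) (delta_gt0 : forall b w, 0 < delta b w)
  (v : V) :
  (forall (rho : B -> V -> R) (M : slicing_system R B V),
     (forall b w, 0 <= rho b w) ->
     (forall w, 0 < overall_load rho w) ->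
     slicing_model rho delta M ->
     btd_gain s rho M v = (gain_formula s delta rho v)%:E)
  /\
  (forall (q : B -> V -> R) (M : (V -> R) -> slicing_system R B V),
     (forall b w, 0 <= q b w) ->
     (forall w, \sum_b q b w = 1) ->
     (forall r : V -> R, (forall w, 0 < r w) ->
        slicing_model (load_of r q) delta (M r)) ->
     [/\ (forall r : V -> R, (forall w, 0 < r w) ->
            btd_gain s (load_of (set_load r v x) q) (M (set_load r v x)) v
              @[x --> 0^'+] --> (gain_light s delta r q v)%:E),
         gain_light s delta r q v @[r --> all_loads 0^'+] --> (1 : R),
         (forall b, cvg (s_bar s (load_of r q) v b
                           @[r --> all_loads (pinfty_nbhs R)])) &
         btd_gain s (load_of r q) (M r) v
           @[r --> all_loads (pinfty_nbhs R)] -->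
         (gain_heavy s delta q
            (fun b => lim (s_bar s (load_of r q) v b
                             @[r --> all_loads (pinfty_nbhs R)])) v)%:E]).
Proof.
split=> [rho M rho0 load0 model|q M q0 q1 model].
  exact: (btd_gainE v s_gt0 s_sum1 delta_gt0 rho0 load0 model).
have sbH := @s_bar_heavy_cvg _ _ _ s v q q0.
split.
- by move=> r r0; exact: cvg_gain_light_load.
- exact: gain_light_cvg1.
- by move=> b; apply/cvg_ex; eexists; exact: sbH.
- rewrite (_ : (fun b => lim _) =
      fun b => \sum_(w | w != v) s w * (q b w == 0)%:R); last first.
    by apply/funext => b; apply/cvg_lim; [exact: Rhausdorff|exact: sbH].
  exact: cvg_gain_heavy_load.
Qed.
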